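(* Let $r,n,s,f,A$ be integers with $n>0$, $r\geq 0$ and $f(r-s)\equiv 0\bmod n$, and let $G$ be the cyclically presented group in class $\mathfrak{M}$ determined by $(r,n,s,f,A)$. Suppose that $G$ is finite and nontrivial, and let $0\leq j<n$. Let $\theta$ denote the shift automorphism of $G$. Then the fixed point subgroup $\mathrm{Fix}(\theta^j)$ has order $|r^{(n,j)}-s^{(n,j)}|$. In particular, the automorphism $\theta^j$ is fixed point free if and only if $(n,j)=|r-s|=1$, in which case $f\equiv 0\bmod n$ and $G$ is cyclic of order $|r^n-s^n|$.
   Context: $(a,b)$ denotes the greatest common divisor, with $(n,0)=n$. For a word $w$ in $x_0,\dots,x_{n-1}$, $G_n(w)=\langle x_0,\dots,x_{n-1}\mid w,\theta(w),\dots,\theta^{n-1}(w)\rangle$ where $\theta(x_i)=x_{i+1}$, subscripts modulo $n$; $\theta$ induces an automorphism of $G_n(w)$, also denoted $\theta$ and called the shift. The cyclically presented group in class $\mathfrak{M}$ determined by $(r,n,s,f,A)$ (with $n>0$, $r\ge 0$, $f(r-s)\equiv 0\bmod n$) is $G=G_n(w)$ where $w=\prod_{i=0}^{r-1}x_{if}\left(\prod_{i=0}^{s-1}x_{A+if}\right)^{-1}$ if $s\geq 0$ and $w=\prod_{i=0}^{r-1}x_{if}\prod_{i=0}^{|s|-1}x_{A+(r+i)f}$ if $s\leq 0$. $\mathrm{Fix}(\theta^j)=\{g\in G:\theta^j(g)=g\}$; an automorphism is fixed point free if its only fixed point is the identity. *)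

(* Defs.v *)
From HB Require Import structures.
From mathcomp Require Import all_boot all_order all_algebra.
From mathcomp Require Import mathcomp_extra boolp classical_sets functions.
From mathcomp Require Import cardinality.

Set Implicit Arguments.
Unset Strict Implicit.
Unset Printing Implicit Defensive.

Local Open Scope quotient_scope.

(* A letter (x, false) stands for x, a letter (x, true) for x^-1. *)
Definition word (X : Type) := seq (X * bool).

Definition inv_letter (X : Type) (a : X * bool) : X * bool := (a.1, ~~ a.2).

Definition inv_word (X : Type) (u : word X) : word X :=
  rev [seq inv_letter a | a <- u].

(* Equality of u and v in the group < X | R >: the least congruence for
   concatenation containing free cancellation and killing the relators. *)
Inductive pres_eq (X : eqType) (R : seq (word X)) : word X -> word X -> Prop :=
| pres_refl u : pres_eq R u u
| pres_sym u v : pres_eq R u v -> pres_eq R v u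
| pres_trans v u w : pres_eq R u v -> pres_eq R v w -> pres_eq R u w
| pres_cat u u' v v' :
    pres_eq R u u' -> pres_eq R v v' -> pres_eq R (u ++ v) (u' ++ v')
| pres_cancel a : pres_eq R [:: a; inv_letter a] [::]
| pres_rel u : u \in R -> pres_eq R u [::].

Section PresentedGroup.
Variables (X : choiceType) (R : seq (word X)).
Local Notation pweq := (pres_eq R).

Definition pres_eqb : rel (seq (X * bool)) := fun u v => `[< pweq u v >].

Fact pres_eqb_refl : reflexive pres_eqb.
Proof. by move=> u; apply/asboolP; apply: pres_refl. Qed.

Fact pres_eqb_sym : symmetric pres_eqb.
Proof. by move=> u v; apply/asboolP/asboolP; apply: pres_sym. Qed.

Fact pres_eqb_trans : transitive pres_eqb.
Proof.
by move=> v u w /asboolP uv /asboolP vw; apply/asboolP; apply: pres_trans vw.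
Qed.

Canonical pres_equiv :=
  EquivRel pres_eqb pres_eqb_refl pres_eqb_sym pres_eqb_trans.

(* The group < X | R >; it may be infinite. *)
Definition pres_group := {eq_quot pres_eqb}.

HB.instance Definition _ := Choice.on pres_group.
HB.instance Definition _ := EqQuotient.on pres_group.

Definition pi_word (u : word X) : pres_group := \pi_pres_group u.

Lemma pi_wordP u v : pi_word u = pi_word v <-> pweq u v.
Proof. by split=> [/eqquotP/asboolP|uv]; last by apply/eqquotP/asboolP. Qed.

Lemma repr_wordK (g : pres_group) : pi_word (repr g) = g.
Proof. exact: reprK. Qed.

Lemma repr_word_eq u : pweq (repr (pi_word u)) u.
Proof. by apply/pi_wordP; rewrite repr_wordK. Qed.

Definition pres_one : pres_group := pi_word [::].
Definition pres_mul (g h : pres_group) : pres_group :=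
  pi_word (repr g ++ repr h).
Definition pres_inv (g : pres_group) : pres_group :=
  pi_word (inv_word (repr g)).

Lemma pres_mulE u v : pres_mul (pi_word u) (pi_word v) = pi_word (u ++ v).
Proof. by apply/pi_wordP; apply: pres_cat; apply: repr_word_eq. Qed.

Lemma inv_wordK : involutive (@inv_word X).
Proof.
move=> u; rewrite /inv_word map_rev revK -map_comp -[RHS]map_id.
by apply: eq_map => -[x b] /=; rewrite /inv_letter /= negbK.
Qed.

Lemma cat_inv_word u : pweq (u ++ inv_word u) [::].
Proof.
elim: u => [|a u IHu]; first exact: pres_refl.
have -> : (a :: u) ++ inv_word (a :: u) =
    [:: a] ++ ((u ++ inv_word u) ++ [:: inv_letter a]).
  by rewrite /inv_word /= rev_cons -cats1 !catA.
apply: pres_trans (pres_cancel R a).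
rewrite -[[:: a; _]]/([:: a] ++ ([::] ++ [:: inv_letter a])).
apply: pres_cat; first exact: pres_refl.
by apply: pres_cat => //; apply: pres_refl.
Qed.

Fact pres_mulA : associative pres_mul.
Proof.
by move=> g h k; rewrite -(repr_wordK g) -(repr_wordK h) -(repr_wordK k)
  !pres_mulE catA.
Qed.

Fact pres_mul1g : left_id pres_one pres_mul.
Proof. by move=> g; rewrite -(repr_wordK g) pres_mulE. Qed.

Fact pres_mulg1 : right_id pres_one pres_mul.
Proof. by move=> g; rewrite -(repr_wordK g) pres_mulE cats0. Qed.

Fact pres_mulgV : right_inverse pres_one pres_inv pres_mul.
Proof.
move=> g; rewrite -{1}(repr_wordK g) /pres_inv pres_mulE.
by apply/pi_wordP; apply: cat_inv_word.
Qed.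

Fact pres_mulVg : left_inverse pres_one pres_inv pres_mul.
Proof.
move=> g; rewrite -{2}(repr_wordK g) /pres_inv pres_mulE.
by apply/pi_wordP; rewrite -{2}(inv_wordK (repr g)); apply: cat_inv_word.
Qed.

HB.instance Definition _ := isGroup.Build pres_group
  pres_mulA pres_mul1g pres_mulg1 pres_mulVg pres_mulgV.

End PresentedGroup.

(* The generators x_0, ..., x_(n-1) are the elements of 'I_n, and
   ordS : 'I_n -> 'I_n is i |-> i + 1 modulo n. *)
Definition shift_word (n : nat) (u : word 'I_n) : word 'I_n :=
  [seq (ordS a.1, a.2) | a <- u].

(* w, theta(w), ..., theta^(n-1)(w) *)
Definition cyc_relators (n : nat) (w : word 'I_n) : seq (word 'I_n) :=
  mkseq (fun k => iter k (@shift_word n) w) n.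

(* G_n(w) *)
Definition cyc_group (n : nat) (w : word 'I_n) : groupType :=
  pres_group (cyc_relators w).

Lemma iter_ordS (n k : nat) (i : 'I_n) : iter k (@ordS n) i = (i + k) %% n :> nat.
Proof.
elim: k => [|k IHk] /=; first by rewrite addn0 modn_small.
by rewrite IHk -addn1 modnDml addn1 addnS.
Qed.

Lemma iter_shift_word (n : nat) (u : word 'I_n) : iter n (@shift_word n) u = u.
Proof.
have E k : iter k (@shift_word n) u = [seq (iter k (@ordS n) a.1, a.2) | a <- u].
  elim: k => [|k IHk] /=; first by rewrite -[LHS]map_id; apply: eq_map => -[].
  by rewrite IHk /shift_word -map_comp.
rewrite E -[RHS]map_id; apply: eq_map => -[i b] /=; congr pair.
by apply: ord_inj; rewrite iter_ordS modnDr modn_small.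
Qed.

Lemma shift_word_eq (n : nat) (w u v : word 'I_n) :
  pres_eq (cyc_relators w) u v ->
  pres_eq (cyc_relators w) (shift_word u) (shift_word v).
Proof.
elim=> {u v} [u|u v _|v u t _ uv _|u u' v v' _ uu' _ vv'|a|u].
- exact: pres_refl.
- exact: pres_sym.
- exact: pres_trans uv.
- by rewrite /shift_word !map_cat; apply: pres_cat.
- exact: (pres_cancel _ (ordS a.1, a.2)).
case/mapP=> k; rewrite mem_iota /= add0n => ltkn ->.
apply: pres_rel; rewrite -iterS.
have [ltk1n|] := ltnP k.+1 n.
  by apply/mapP; exists k.+1 => //; rewrite mem_iota.
move=> lenk1; have Ek : k.+1 = n by apply/eqP; rewrite eqn_leq ltkn.
apply/mapP; exists 0; first by rewrite mem_iota (leq_ltn_trans _ ltkn).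
by rewrite Ek iter_shift_word.
Qed.

Section Shift.
Variables (n : nat) (w : word 'I_n).

Definition shift (g : cyc_group w) : cyc_group w :=
  pi_word (cyc_relators w) (shift_word (repr g)).

Lemma shift_pi (u : word 'I_n) :
  shift (pi_word (cyc_relators w) u) = pi_word (cyc_relators w) (shift_word u).
Proof. by apply/pi_wordP; apply: shift_word_eq; apply: repr_word_eq. Qed.

Lemma shiftM : {morph shift : g h / (g * h)%g}.
Proof.
move=> g h; rewrite -(repr_wordK g) -(repr_wordK h).
rewrite -[(_ * _)%g in LHS]/(pres_mul _ _) -[RHS]/(pres_mul _ _).
by rewrite pres_mulE !shift_pi pres_mulE /shift_word map_cat.
Qed.

Lemma shift1 : shift 1%g = 1%g.
Proof. exact: shift_pi [::]. Qed.

HB.instance Definition _ :=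
  isUMagmaMorphism.Build (cyc_group w) (cyc_group w) shift (shift1, shiftM).

Lemma iter_shift (g : cyc_group w) : iter n shift g = g.
Proof.
rewrite -{1}(repr_wordK g).
have E k u : iter k shift (pi_word _ u) = pi_word _ (iter k (@shift_word n) u).
  by elim: k => //= k ->; rewrite shift_pi.
by rewrite E iter_shift_word repr_wordK.
Qed.

End Shift.

Import GRing.Theory Num.Theory.
Local Open Scope ring_scope.

Fact subscript_proof (n : nat) (n_gt0 : (0 < n)%N) (i : int) :
  (`|(i %% n)%Z| < n)%N.
Proof.
have nz : n%:Z != 0 by rewrite -lt0n.
by rewrite -ltz_nat gez0_abs ?modz_ge0 // ltz_pmod.
Qed.

(* The residue modulo n of an integer subscript. *)
Definition subscript (n : nat) (n_gt0 : (0 < n)%N) (i : int) : 'I_n :=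
  Ordinal (subscript_proof n_gt0 i).

(* x_{e 0} x_{e 1} ... x_{e (m - 1)} *)
Definition gen_prod (n : nat) (n_gt0 : (0 < n)%N) (m : nat) (e : nat -> int) :
    word 'I_n :=
  mkseq (fun i => (subscript n_gt0 (e i), false)) m.

Definition classM_word (n : nat) (n_gt0 : (0 < n)%N) (r : nat) (s f A : int) :
    word 'I_n :=
  if 0 <= s then
    gen_prod n_gt0 r (fun i => i%:Z * f)
      ++ inv_word (gen_prod n_gt0 `|s| (fun i => A + i%:Z * f))
  else
    gen_prod n_gt0 r (fun i => i%:Z * f)
      ++ gen_prod n_gt0 `|s| (fun i => A + (r%:Z + i%:Z) * f).

Definition classM_group (n : nat) (n_gt0 : (0 < n)%N) (r : nat) (s f A : int) :
    groupType :=
  cyc_group (classM_word n_gt0 r s f A).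

Definition classM_shift (n : nat) (n_gt0 : (0 < n)%N) (r : nat) (s f A : int) :
    classM_group n_gt0 r s f A -> classM_group n_gt0 r s f A :=
  @shift n (classM_word n_gt0 r s f A).

Local Open Scope classical_set_scope.
Local Open Scope group_scope.

Definition Fix (G : Type) (phi : G -> G) : set G := [set g | phi g = g].

Definition fixed_point_free (G : groupType) (phi : G -> G) : Prop :=
  Fix phi = [set 1].

Definition expgz (G : groupType) (g : G) (k : int) : G :=
  match k with Posz m => g ^+ m | Negz m => g ^- m.+1 end.

Definition cyclic_group (G : groupType) : Prop :=
  exists g : G, forall h : G, exists k : int, h = expgz g k.

(* Main.v *)
Require Import Defs.
From HB Require Import structures.
From mathcomp Require Import all_boot all_order all_algebra all_field.
From mathcomp Require Import mathcomp_extra boolp classical_sets functions.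
From mathcomp Require Import cardinality.
From mathcomp Require Import zify ring.

Set Implicit Arguments.
Unset Strict Implicit.
Unset Printing Implicit Defensive.

Import Order.TTheory GRing.Theory Num.Theory.

(** Write a for the shift of G and y for the bijection g |-> x_0 * a^f(g) of
    the set G.  A product of generators with subscripts in arithmetic
    progression of difference f telescopes into a power of y, so the n relators
    of the presentation collapse to the single relation

      y^r a^A = a^A y^s   together with   a^n = 1            (twisted_gen_rel).

    The split extension E of G by <a> is the group with these relations, and G
    is, as a set, the coset space E / <a>.  Concretely: G is one orbit of a and
    y (twisted_gen_orbit), and whenever two bijections of a type T satisfy the
    two relations and the first fixes t0, there is an equivariant map G -> T
    that takes 1 to t0 (orbit_map).  Elements of G are thus distinguished by
    exhibiting suitable bijections of familiar types, and the whole group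
    structure of G can be forgotten: the action of a on the set G is the shift.

    Upper bound.  Iterating the relation m times, where n divides A m, gives
    y^(r^m - s^m) = 1 (relation_power); take m = n and let N = r^n - s^n.  If r
    and s are coprime and A is invertible modulo n, then s is invertible modulo
    N, the relation says that a^A conjugates y to y^(r/s), and so a conjugates
    y to y^v, where v is a power of r/s (exists_multiplier).  Since a fixes 1,
    the orbit of 1 is { y^i 1 }, and a sends y^i 1 to y^(v i) 1.

    Lower bound.  Multiplication by v and translation by 1 on Z/N satisfy the
    relations (affine_model), so the points y^i 1, for i modulo N, are
    distinct.  Hence G is Z/N as a set with shift i |-> v i, and Fix(theta^j)
    is the set of i with (v^j - 1) i = 0, of cardinal gcd(N, v^j - 1).  Up to
    units modulo N this is gcd(r^n - s^n, r^k - s^k) with k a multiple of j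
    such that (n, k) = (n, j), which is |r^(n,j) - s^(n,j)| (gcdz_diffX).

    Coprimality.  It remains to see that, for n > 1, a finite nontrivial G has
    r, s coprime and A, n coprime (finite_coprime).  Otherwise let a act on
    functions from Z/n to the algebraic numbers by rotating the index, and let
    y act on the i-th coordinate as z |-> mu_i (z - c_i) + c_i, with mu_i a
    root of unity.  As soon as c_0 <> c_1 and mu_0, mu_1 <> 1, the commutator of
    y and its conjugate by a is a nonzero translation in the coordinate 0, so
    that G is infinite (rotations_infinite).  A common prime divisor of r and s
    provides such mu and c; so does, when d = (n, A) > 1, any prime divisor of
    r^(n/d) - s^(n/d).  If the latter number is 1 or -1, then y = 1 and G is
    trivial. *)

(** * Integer powers in a group *)

Section IntegerPowers.
Local Open Scope group_scope.
Variable G : groupType.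
Implicit Types (g h : G) (i j : int).

Lemma expgz_nat g n : expgz g (Posz n) = g ^+ n. Proof. by []. Qed.

Lemma expgzN g i : expgz g (- i)%R = (expgz g i)^-1.
Proof.
case: i => [[|n]|n] /=; first by rewrite invg1.
  by [].
by rewrite invgK.
Qed.

Lemma expgzS g i : expgz g (i + 1)%R = g * expgz g i.
Proof.
case: i => [n|[|n]].
- by rewrite -PoszD addn1 /= expgS.
- by rewrite /= expg1 mulgV.
rewrite NegzE (_ : _ + 1 = - (n.+1)%:Z)%R; last by lia.
by rewrite !expgzN !expgz_nat [in RHS]expgSr invgM mulgA mulgV mul1g.
Qed.

Lemma expgzD g i j : expgz g (i + j)%R = expgz g i * expgz g j.
Proof.
have D (n : nat) k : expgz g (n%:Z + k)%R = g ^+ n * expgz g k.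
  elim: n => [|n IHn]; first by rewrite add0r mul1g.
  by rewrite (_ : n.+1%:Z + k = n%:Z + k + 1)%R; [rewrite expgzS IHn mulgA expgS|lia].
case: i => [n|n]; first exact: D.
apply: (mulgI (g ^+ n.+1)); rewrite mulgA mulgV mul1g -D; congr expgz.
by rewrite NegzE; lia.
Qed.

Lemma expgzM g i j : expgz g (i * j)%R = expgz (expgz g i) j.
Proof.
have M (n : nat) : expgz g (i * n%:Z)%R = expgz g i ^+ n.
  elim: n => [|n IHn]; first by rewrite mulr0.
  by rewrite (_ : i * n.+1%:Z = i + i * n%:Z)%R; [rewrite expgzD IHn expgS|lia].
case: j => [n|n]; first exact: M.
by rewrite NegzE mulrN !expgzN M.
Qed.

Lemma expgz1 g : expgz g 1 = g. Proof. by []. Qed.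

Lemma expgz_comm g i j : expgz (expgz g i) j = expgz (expgz g j) i.
Proof. by rewrite -!expgzM mulrC. Qed.

(** Conjugation by h commutes with taking powers; stated without inverses, as
    the relations below are. *)
Lemma expgz_intertwine h g1 g2 i :
  h * g1 = g2 * h -> h * expgz g1 i = expgz g2 i * h.
Proof.
move=> E; have P n : h * g1 ^+ n = g2 ^+ n * h.
  elim: n => [|n IHn]; first by rewrite mul1g mulg1.
  by rewrite expgSr mulgA IHn -mulgA E mulgA -expgSr.
case: i => n; first exact: P.
by apply: (mulgI (g2 ^+ n.+1)); rewrite mulgA -P -mulgA /= mulgV mulg1 mulgA mulgV mul1g.
Qed.

Lemma expgz_eq_mod g (N : int) i j :
  expgz g N = 1 -> (i = j %[mod N])%Z -> expgz g i = expgz g j.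
Proof.
move=> gN /eqP; rewrite eqz_mod_dvd => /dvdzP[q E].
have -> : i = (N * q + j)%R by rewrite mulrC -E subrK.
rewrite expgzD expgzM gN (_ : expgz 1 q = 1) ?mul1g //.
by case: q {E} => q /=; rewrite expg1n ?invg1.
Qed.

End IntegerPowers.

Lemma gmulf_expgz (G H : groupType) (phi : G -> H) (g : G) (i : int) :
  {morph phi : x y / (x * y)%g} -> phi (expgz g i) = expgz (phi g) i.
Proof.
move=> phiM; have phi1 : phi 1%g = 1%g.
  by apply: (mulgI (phi 1%g)); rewrite -phiM !mulg1.
have P n : phi (g ^+ n)%g = (phi g ^+ n)%g.
  by elim: n => [|n IHn] //; rewrite !expgS phiM IHn.
case: i => n; first exact: P.
rewrite /= -P; apply: (mulgI (phi (g ^+ n.+1)%g)).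
by rewrite -phiM !mulgV.
Qed.

(** * The group of bijections of a type *)

(** The inverse is data, so that the group law computes on points; by
    extensionality it does not add distinct elements (bij_ext). *)
Record bij_of (T : Type) := MkBij {
  bfun :> T -> T; binv : T -> T;
  bfunK : cancel bfun binv; binvK : cancel binv bfun }.

Section BijectionGroup.
Variable T : Type.
Implicit Types g h : bij_of T.

Lemma bij_ext g h : g =1 h -> g = h.
Proof.
case: g h => f f' fK f'K [k k' kK k'K] /= /funext E; case: k / E kK k'K => kK k'K.
have E : f' = k' by apply/funext => x; rewrite -{1}(k'K x) fK.
by case: k' / E kK k'K => kK k'K; congr MkBij; apply: Prop_irrelevance.
Qed.

HB.instance Definition _ := gen_eqMixin (bij_of T).
HB.instance Definition _ := gen_choiceMixin (bij_of T).

Definition bij_one : bij_of T := @MkBij T id id (fun=> erefl) (fun=> erefl).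
Definition bij_mul g h : bij_of T :=
  MkBij (can_comp (bfunK g) (bfunK h)) (can_comp (binvK h) (binvK g)).
Definition bij_inv g : bij_of T := MkBij (binvK g) (bfunK g).

Fact bij_mulA : associative bij_mul. Proof. by move=> *; apply: bij_ext. Qed.
Fact bij_mul1g : left_id bij_one bij_mul. Proof. by move=> *; apply: bij_ext. Qed.
Fact bij_mulg1 : right_id bij_one bij_mul. Proof. by move=> *; apply: bij_ext. Qed.
Fact bij_mulVg : left_inverse bij_one bij_inv bij_mul.
Proof. by move=> g; apply: bij_ext => x /=; rewrite bfunK. Qed.
Fact bij_mulgV : right_inverse bij_one bij_inv bij_mul.
Proof. by move=> g; apply: bij_ext => x /=; rewrite binvK. Qed.

HB.instance Definition _ := isGroup.Build (bij_of T)
  bij_mulA bij_mul1g bij_mulg1 bij_mulVg bij_mulgV.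

Lemma bij_mulE g h x : (g * h)%g x = g (h x). Proof. by []. Qed.

Lemma bij_expE g n x : (g ^+ n)%g x = iter n g x.
Proof. by elim: n => //= n IHn; rewrite expgS bij_mulE IHn. Qed.

End BijectionGroup.

Lemma equivariant_expgz (S T : Type) (tau : S -> T)
    (g : bij_of S) (h : bij_of T) i x :
  (forall x, tau (g x) = h (tau x)) -> tau (expgz g i x) = expgz h i (tau x).
Proof.
move=> E; have P m y : tau ((g ^+ m)%g y) = (h ^+ m)%g (tau y).
  by elim: m y => // m IHm y; rewrite !expgS !bij_mulE E IHm.
case: i => m; first exact: P.
by rewrite -[LHS](bfunK (h ^+ m.+1)%g) -P /= binvK.
Qed.

Definition left_mul (G : groupType) (g : G) : bij_of G :=
  @MkBij G (fun h => g * h)%g (fun h => g^-1 * h)%g (mulKg g) (mulVKg g).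

Lemma left_mulM (G : groupType) : {morph @left_mul G : g h / (g * h)%g}.
Proof. by move=> g h; apply: bij_ext => k /=; rewrite mulgA. Qed.

(** * Evaluating words in a group *)

Section Evaluation.
Local Open Scope group_scope.
Variables (X : eqType) (H : groupType) (phi : X -> H).

Definition eval_letter (a : X * bool) : H := if a.2 then (phi a.1)^-1 else phi a.1.

Definition eval_word (u : word X) : H := foldr (fun a h => eval_letter a * h) 1 u.

Lemma eval_cat u v : eval_word (u ++ v) = eval_word u * eval_word v.
Proof. by elim: u => /= [|a u ->]; rewrite ?mul1g ?mulgA. Qed.

Lemma eval_inv u : eval_word (inv_word u) = (eval_word u)^-1.
Proof.
elim: u => [|a u IHu] /=; first by rewrite invg1.
rewrite /inv_word /= rev_cons -cats1 eval_cat [X in X * _]IHu invgM /= mulg1.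
by congr (_ * _); case: a => x [] //=; rewrite /eval_letter /= invgK.
Qed.

Lemma eval_pres_eq (R : seq (word X)) u v :
  (forall r, r \in R -> eval_word r = 1) -> pres_eq R u v ->
  eval_word u = eval_word v.
Proof.
move=> R1; elim=> {u v} //= [v u w _ -> _ ->|u u' v v' _ E _ E'|a] //.
  by rewrite !eval_cat E E'.
by case: a => x []; rewrite /eval_letter /= mulg1 ?mulgV ?mulVg.
Qed.

End Evaluation.

(** The regular representation; it turns the relators of a presentation into
    identities between bijections of the presented group. *)
Lemma eval_left_mul (X : choiceType) (R : seq (word X)) (u : word X) :
  eval_word (fun x => left_mul (pi_word R [:: (x, false)])) u
    = left_mul (pi_word R u).
Proof.
have M v w : left_mul (pi_word R (v ++ w))
    = (left_mul (pi_word R v) * left_mul (pi_word R w))%g.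
  by rewrite -left_mulM; congr left_mul; rewrite -pres_mulE.
have one : left_mul (pi_word R [::]) = 1%g.
  by apply: bij_ext => g; apply: pres_mul1g.
elim: u => [|[x b] u IHu]; first by rewrite one.
rewrite -cat1s M -IHu /=; congr (_ * _)%g.
rewrite /eval_letter /=; case: b => //.
apply: (mulgI (left_mul (pi_word R [:: (x, false)]))).
rewrite mulgV -M -one; congr left_mul; apply/pi_wordP/pres_sym.
exact: (pres_cancel R (x, false)).
Qed.

(** * Class M groups as transformation groups *)

Section ShiftAction.
Local Open Scope group_scope.
Variables (n : nat) (n_gt0 : (0 < n)%N) (f : int).
Variables (H : groupType) (a y : H).
Hypothesis an1 : a ^+ n = 1.

(** The image of the generator x_i when a realizes the shift as a conjugation
    and x_0 = y a^-f; this substitution of y for x_0 is what makes the relators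
    telescope. *)
Definition conj_gen (i : 'I_n) : H := a ^+ i * (y * expgz a (- f)) * a ^- i.

Lemma expgz_modn (i : int) : expgz a (i %% n)%Z = expgz a i.
Proof. by apply: (@expgz_eq_mod _ _ n); rewrite ?modz_mod. Qed.

Lemma conj_gen_subscript (i : int) :
  conj_gen (subscript n_gt0 i)
    = expgz a i * (y * expgz a (- f)) * expgz a (- i)%R.
Proof.
have E : a ^+ subscript n_gt0 i = expgz a i.
  rewrite -expgz_nat (_ : Posz _ = (i %% n)%Z) ?expgz_modn //.
  by rewrite -[RHS]gez0_abs // modz_ge0 // -lt0n.
by rewrite /conj_gen E expgzN [in RHS]expgzN.
Qed.

Lemma conj_gen_ordS (i : 'I_n) : conj_gen (ordS i) = a * conj_gen i * a^-1.
Proof.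
have E : a ^+ ordS i = a * a ^+ i.
  by rewrite -expgS -!expgz_nat -(expgz_modn i.+1%:Z) modz_nat.
by rewrite /conj_gen E invgM !mulgA.
Qed.

Lemma eval_shift_word u :
  eval_word conj_gen (shift_word u) = a * eval_word conj_gen u * a^-1.
Proof.
elim: u => [|[x b] u IHu] /=; first by rewrite mulg1 mulgV.
rewrite IHu !mulgA; congr (_ * _ * _); rewrite /eval_letter /= conj_gen_ordS.
by case: b; rewrite ?invgM ?invgK ?mulgA mulgVK.
Qed.

(** The factors are a^(k + i f) y a^-(k + (i + 1) f), whose inner powers of a
    cancel. *)
Lemma eval_gen_prod m (e : nat -> int) (k : int) :
  (forall i, e i = k + i%:Z * f)%R ->
  eval_word conj_gen (gen_prod n_gt0 m e)
    = expgz a k * y ^+ m * expgz a (- (k + m%:Z * f))%R.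
Proof.
move=> eE; elim: m => [|m IHm].
  by rewrite mul0r addr0 mulg1 -expgzD subrr.
rewrite /gen_prod /mkseq -addn1 iotaD map_cat eval_cat [X in X * _]IHm /= add0n mulg1.
rewrite /eval_letter /= conj_gen_subscript eE addn1 expgSr !mulgA.
rewrite -(mulgA (_ * y ^+ m)) -expgzD addNr mulg1 -!mulgA -!expgzD.
by congr (_ * (_ * (_ * expgz _ _))); lia.
Qed.

(** Both sign cases of the defining word give the same relation.  The powers
    of a that end the two telescoped products differ by a^(f (s - r)), which
    the congruence on f makes trivial. *)
Lemma eval_classM_word (r : nat) (s A : int) :
  (f * (r%:Z - s) = 0 %[mod n])%Z ->
  eval_word conj_gen (classM_word n_gt0 r s f A)
    = y ^+ r * expgz a A * (expgz a A * expgz y s)^-1.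
Proof.
move=> frs; rewrite /classM_word.
have P0 : eval_word conj_gen (gen_prod n_gt0 r (fun i => (i%:Z * f)%R))
    = y ^+ r * expgz a (- (r%:Z * f))%R.
  by rewrite (@eval_gen_prod _ _ 0%R) ?mul1g ?add0r // => i; rewrite add0r.
have E : expgz a (- (r%:Z * f) + s * f)%R = 1.
  apply: (@expgz_eq_mod _ _ n _ 0%R) => //.
  have -> : (- (r%:Z * f) + s * f = - (f * (r%:Z - s)))%R by ring.
  move/eqP: frs; rewrite eqz_mod_dvd subr0 => frs.
  by apply/eqP; rewrite eqz_mod_dvd subr0 dvdzE abszN.
case: ifP => [s0|/negbT]; last rewrite -ltNge => s0; rewrite eval_cat P0.
  rewrite eval_inv (@eval_gen_prod _ _ A) // -(expgz_nat y `|s|%N) gez0_abs //.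
  rewrite [in LHS]invgM.
  rewrite -expgzN opprK mulgA -(mulgA (y ^+ r)) -expgzD; congr (_ * _ * _).
  by rewrite addrCA expgzD E mulg1.
rewrite (@eval_gen_prod _ _ (A + r%:Z * f)%R); last by move=> i; ring.
rewrite -(expgz_nat y `|s|%N) ltz0_abs // (expgzN y) !mulgA -(mulgA (y ^+ r)) -expgzD.
rewrite addrCA addNr addr0 invgM mulgA; congr (_ * _).
rewrite (_ : - _ = - A + (- (r%:Z * f) + s * f))%R; last by ring.
by rewrite expgzD E mulg1 expgzN.
Qed.

End ShiftAction.

Lemma fixed_expgz (T : Type) (g : bij_of T) t i : g t = t -> expgz g i t = t.
Proof.
move=> gt; have P m : (g ^+ m)%g t = t.
  by elim: m => // m IHm; rewrite expgS bij_mulE IHm.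
case: i => m; first exact: P.
by rewrite -{1}(P m.+1); apply: bfunK.
Qed.

Section ClassM.
Local Open Scope group_scope.
Variables (n : nat) (n_gt0 : (0 < n)%N) (r : nat) (s f A : int).
Hypothesis frs : (f * (r%:Z - s) = 0 %[mod n])%Z.

Local Notation w := (classM_word n_gt0 r s f A).
Local Notation G := (classM_group n_gt0 r s f A).
Local Notation gen i := (pi_word (cyc_relators w) [:: (i, false)] : G).

Fact shift_can : cancel (@shift n w) (iter n.-1 (@shift n w)).
Proof. by move=> g; rewrite -iterSr prednK // iter_shift. Qed.

Fact shift_can' : cancel (iter n.-1 (@shift n w)) (@shift n w).
Proof. by move=> g; rewrite -iterS prednK // iter_shift. Qed.

Definition shift_bij : bij_of G := MkBij shift_can shift_can'.

(** The element y = x_0 a^f of the split extension of G by its shift, in its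
    action on the set G. *)
Definition twisted_gen : bij_of G :=
  left_mul (gen (Ordinal n_gt0)) * expgz shift_bij f.

Local Notation a := shift_bij.
Local Notation y := twisted_gen.

Lemma shift_bij_order : a ^+ n = 1.
Proof. by apply: bij_ext => g; rewrite bij_expE iter_shift. Qed.

Lemma shift_bij1 : a 1 = 1. Proof. exact: shift1. Qed.

Lemma shift_left_mul (g : G) : a * left_mul g = left_mul (a g) * a.
Proof. by apply: bij_ext => h; apply: shiftM. Qed.

Lemma conj_gen_shift (i : 'I_n) : conj_gen f a y i = left_mul (gen i).
Proof.
rewrite /conj_gen /twisted_gen -(mulgA (left_mul _)) -expgzD subrr mulg1.
have P k (g : G) : a ^+ k * left_mul g = left_mul (iter k a g) * a ^+ k.
  elim: k g => [|k IHk] g; first by rewrite mul1g mulg1.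
  by rewrite expgSr -mulgA shift_left_mul mulgA IHk -mulgA -expgSr iterSr.
rewrite P mulgK; congr left_mul.
have E k u : iter k a (pi_word _ u : G)
    = pi_word (cyc_relators w) (iter k (@shift_word n) u).
  by elim: k => //= k ->; rewrite shift_pi.
rewrite E; congr pi_word.
have {}E k (x : 'I_n) b :
    iter k (@shift_word n) [:: (x, b)] = [:: (iter k (@ordS n) x, b)].
  by elim: k => //= k ->.
by rewrite E (_ : iter i _ _ = i) //; apply: ord_inj; rewrite iter_ordS add0n modn_small.
Qed.

(** The relator w represents 1, so left multiplication by it is the identity;
    by conj_gen_shift it is also the value of w at the pair a, y. *)
Lemma twisted_gen_rel : y ^+ r * expgz a A = expgz a A * expgz y s.
Proof.
apply: divg1_eq; rewrite -(@eval_classM_word _ n_gt0 f _ _ _ shift_bij_order) //.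
rewrite (funext conj_gen_shift) eval_left_mul.
apply: bij_ext => g /=.
have -> : pi_word (cyc_relators w) w = 1 :> G.
  by apply/pi_wordP/pres_rel/mapP; exists 0; rewrite // mem_iota.
exact: mul1g.
Qed.

(** Left multiplication by x_i is a^i y a^-(f + i), and G is generated by the
    x_i, so that a and y act transitively on G. *)
Lemma twisted_gen_orbit (S : G -> Prop) :
  S 1 -> (forall g, S g -> S (a g)) -> (forall g i, S g -> S (expgz y i g)) ->
  forall g, S g.
Proof.
move=> S1 Sa Sy g; rewrite -(repr_wordK g).
have San k h : S h -> S (expgz a k h).
  have P m h' : S h' -> S ((a ^+ m) h').
    by elim: m => // m IHm /IHm; rewrite expgS bij_mulE => /Sa.
  case: k => m; first exact: P.
  (* S is only closed under a itself; its inverse is the power n - 1 *)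
  have -> : expgz a (Negz m) = a ^+ (m.+1 * n.-1); last exact: P.
  apply: (mulgI (a ^+ m.+1)); rewrite mulgV -expgnDr -mulnS prednK //.
  by rewrite mulnC expgnA shift_bij_order expg1n.
suff P u h : S h -> S (bfun (eval_word (fun x => left_mul (gen x)) u) h).
  by have := P (repr g) _ S1; rewrite eval_left_mul /= mulg1.
rewrite -(funext conj_gen_shift); elim: u h => //= -[x b] u IHu h /IHu.
set t := bfun (eval_word _ u) h => St.
rewrite -[X in S X]/(bfun (eval_letter (conj_gen f a y) (x, b)) t).
have E : conj_gen f a y x = expgz a x * expgz y 1 * expgz a (- f - x%:Z)%R.
  by rewrite expgzD (expgzN a x) /conj_gen !mulgA.
have [i [j [k ->]]] : exists i j k,
    eval_letter (conj_gen f a y) (x, b) = expgz a i * (expgz y j * expgz a k).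
  rewrite /eval_letter /= E; case: b; last first.
    exists x, 1%R, (- f - x%:Z)%R. exact/esym/mulgA.
  exists (- (- f - x%:Z))%R, (-1)%R, (- x%:Z)%R.
  by rewrite !invgM (expgzN a x) (expgzN y 1) (expgzN a (- f - _)%R).
exact/San/Sy/San.
Qed.

(** Two bijections a', y' as below make T a set on which the split extension
    of G acts, and the subgroup generated by the shift fixes t0: the map sends
    g to its image of t0.  All the lower bounds on G come from this lemma. *)
Lemma orbit_map (T : Type) (a' y' : bij_of T) (t0 : T) :
  a' ^+ n = 1 -> a' t0 = t0 -> y' ^+ r * expgz a' A = expgz a' A * expgz y' s ->
  exists tau : G -> T,
    [/\ tau 1 = t0, forall g, tau (a g) = a' (tau g)
      & forall g, tau (y g) = y' (tau g)].
Proof.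
move=> a'n a't0 rel.
pose ev (u : word 'I_n) := eval_word (conj_gen f a' y') u.
have evP u v : pres_eq (cyc_relators w) u v -> ev u = ev v.
  apply: eval_pres_eq => _ /mapP[k _ ->]; elim: k => [|k IHk] /=.
    by rewrite eval_classM_word // rel mulgV.
  by rewrite eval_shift_word // IHk mulg1 mulgV.
have ev_repr u : ev (repr (pi_word (cyc_relators w) u)) = ev u.
  exact/evP/repr_word_eq.
pose tau (g : G) := bfun (ev (repr g)) t0.
have tau_shift g : tau (a g) = a' (tau g).
  rewrite /tau ev_repr /ev eval_shift_word // !bij_mulE; congr (bfun a' (bfun _ _)).
  by rewrite -{1}a't0; apply: bfunK.
exists tau; split=> //; first by rewrite /tau (ev_repr [::]).
move=> g; rewrite /twisted_gen bij_mulE.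
have tau_gen h : tau (gen (Ordinal n_gt0) * h) = y' (expgz a' (- f)%R (tau h)).
  rewrite -{1}(repr_wordK h) -[_ * _]/(pres_mul _ _) pres_mulE /tau ev_repr /ev.
  by rewrite eval_cat.
rewrite [X in tau X]/= tau_gen (equivariant_expgz _ _ tau_shift).
by rewrite -[expgz a' (- f)%R _]bij_mulE -expgzD addNr.
Qed.

End ClassM.

(** * Consequences of the defining relation *)

Section Relation.
Local Open Scope group_scope.
Variables (H : groupType) (n : nat) (a y : H) (r s A : int).
Hypotheses (an1 : a ^+ n = 1).
Hypotheses (rel : expgz y r * expgz a A = expgz a A * expgz y s).

Lemma expgz_order (i : int) : (n %| i)%Z -> expgz a i = 1.
Proof.
case/dvdzP=> q ->; rewrite mulrC expgzM expgz_nat an1.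
by case: q => q /=; rewrite expg1n ?invg1.
Qed.

(** Conjugation by c = a^A takes y^s to y^r, hence c^k takes y^(s^k) to
    y^(r^k): move one factor c at a time, using the r-th power of the previous
    identity. *)
Lemma relation_iter (k : nat) :
  expgz y (r ^+ k)%R * expgz a A ^+ k = expgz a A ^+ k * expgz y (s ^+ k)%R.
Proof.
elim: k => [|k IHk]; first by rewrite mul1g mulg1.
rewrite exprSr expgzM expgSr mulgA -(expgz_intertwine _ (esym IHk)).
rewrite -mulgA expgz_comm -(expgz_intertwine _ (esym rel)) mulgA -expgzM.
by rewrite exprS.
Qed.

Lemma relation_power (m : nat) :
  (n %| (A * m%:Z)%R)%Z -> expgz y (r ^+ m - s ^+ m)%R = 1.
Proof.
move=> nAm; have := relation_iter m.
rewrite -expgz_nat -expgzM expgz_order // mulg1 mul1g expgzD expgzN => ->.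
by rewrite mulgV.
Qed.

(** Raising the relation to the power s', the inverse of s modulo the order of
    y, shows that a^A conjugates y to y^u; the B-th power of a^A is a. *)
Lemma relation_normalize (u s' : int) (B : nat) :
  (forall i k, (i = k %[mod (r ^+ n - s ^+ n)%R])%Z -> expgz y i = expgz y k) ->
  ((s * s')%R = 1 %[mod (r ^+ n - s ^+ n)%R])%Z -> u = (r * s')%R ->
  ((A * B%:Z)%R = 1 %[mod n])%Z ->
  a * y = expgz y (u ^+ B)%R * a.
Proof.
move=> yN ss' -> AB.
have yc : expgz a A * y = expgz y (r * s')%R * expgz a A.
  rewrite -{1}(expgz1 y) -(yN _ _ ss') !expgzM.
  by rewrite (expgz_intertwine _ (esym rel)).
have P k : expgz a A ^+ k * y = expgz y ((r * s') ^+ k)%R * expgz a A ^+ k.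
  elim: k => [|k IHk]; first by rewrite mul1g mulg1.
  rewrite expgS -mulgA IHk mulgA (expgz_intertwine _ yc) -mulgA -expgzM.
  by rewrite exprS.
have E : expgz a A ^+ B = a.
  rewrite -expgz_nat -expgzM -[RHS]expgz1.
  by apply: expgz_eq_mod AB.
by rewrite -{1}E P E.
Qed.

End Relation.

(** * Greatest common divisors of differences of powers *)

Section PowerDifferences.
Local Open Scope ring_scope.
Variables (r s : int).
Hypothesis rs : coprimez r s.

Lemma coprimez_diffX (k : nat) : (0 < k)%N -> coprimez s (r ^+ k - s ^+ k).
Proof.
case: k => // k _; rewrite /coprimez (_ : _ - _ = (- s ^+ k) * s + r ^+ k.+1).
  by rewrite gcdzMDl -/(coprimez _ _) coprimezXr // coprimez_sym.
by rewrite mulNr -exprSr addrC.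
Qed.

(** The Euclidean algorithm on the exponents: for k <= l,
    r^l - s^l = r^(l-k) (r^k - s^k) + s^k (r^(l-k) - s^(l-k)),
    and s is coprime to r^k - s^k. *)
Lemma gcdz_diffX (k l : nat) :
  gcdz (r ^+ k - s ^+ k) (r ^+ l - s ^+ l) = `|r ^+ gcdn k l - s ^+ gcdn k l|.
Proof.
have [m] := ubnP (k + l); elim: m k l => // m IHm k l.
wlog lekl : k l / (k <= l)%N.
  move=> W; case/orP: (leq_total k l) => [/W//|/W Wlk lt]; rewrite gcdzC gcdnC Wlk //.
  by rewrite addnC.
move=> ltm; have [->|k0] := posnP k.
  by rewrite !expr0 subrr gcd0z gcd0n abszE.
have -> : r ^+ l - s ^+ l = r ^+ (l - k) * (r ^+ k - s ^+ k)
    + s ^+ k * (r ^+ (l - k) - s ^+ (l - k)).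
  by rewrite !mulrBr -!exprD subnK // subnKC //; ring.
rewrite gcdzMDl Gauss_gcdzr; last first.
  by rewrite coprimez_sym coprimezXl // coprimez_diffX.
rewrite IHm; last by lia.
by rewrite -[in RHS](subnK lekl) gcdnDr.
Qed.

End PowerDifferences.

(** Multiplication by v on Z/N fixes exactly the multiples of N / gcd(N, v - 1).
    The parametrization P stands for the identification of G with Z/N. *)
Lemma fix_card (G : Type) (P : int -> G) (phi : G -> G) (N v : int) :
  (forall g, exists i, g = P i) -> (forall i k, P i = P k <-> (i = k %[mod N])%Z) ->
  N != 0%R -> (forall i, phi (P i) = P (v * i)%R) ->
  (Fix phi #= `I_(absz (gcdz N (v - 1)%R)))%card.
Proof.
move=> Psurj Pmod N0 phiP; set g := gcdz _ _.
have g0 : (g != 0)%R by rewrite gcdz_eq0 negb_and N0.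
have [q qE] := dvdzP (dvdz_gcdl N (v - 1)%R); rewrite -/g in qE.
have [m mE] := dvdzP (dvdz_gcdr N (v - 1)%R); rewrite -/g in mE.
have q0 : (q != 0)%R by apply: contraNneq N0 => q0; rewrite qE q0 mul0r.
have gg : Posz `|g| = g by rewrite gez0_abs.
have cop : coprimez q m.
  have := mulz_gcdl q m g; rewrite -qE -mE -/g -[RHS]gg -{2}gg => /eqP.
  by rewrite -{2}(mul1r (Posz _)) (inj_eq (mulIf _)) // gg.
have FixP i : Fix phi (P i) <-> (q %| i)%Z.
  rewrite /Fix /= phiP Pmod -[X in X <-> _]/(_ = _).
  split=> [/eqP|H]; last apply/eqP; rewrite eqz_mod_dvd -{2}(mul1r i) -mulrBl qE mE.
    by rewrite (mulrC m) -mulrA (mulrC q) dvdz_mul2l // Gauss_dvdzr.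
  by rewrite (mulrC m) -mulrA (mulrC q) dvdz_mul2l // Gauss_dvdzr.
have -> : Fix phi = ((fun k : nat => P (k%:Z * q)%R) @` `I_(absz g))%classic.
  apply/seteqP; split=> [x|_ [k _ <-]]; last exact/FixP/dvdz_mull.
  have [i ->] := Psurj x; move/FixP=> /dvdzP[z ->].
  have zg : Posz `|(z %% g)%Z|%N = (z %% g)%Z by rewrite gez0_abs // modz_ge0.
  exists `|(z %% g)%Z|%N.
    by rewrite /= -ltz_nat zg gg -[X in (_ < X)%R]gg ltz_mod.
  apply/Pmod; rewrite zg; apply/eqP.
  by rewrite eqz_mod_dvd -mulrBl qE mulrC dvdz_mul2l // -eqz_mod_dvd modz_mod.
apply: inj_card_eq => k l /set_mem /= kg /set_mem /= lg /Pmod /eqP.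
rewrite eqz_mod_dvd -mulrBl qE mulrC dvdz_mul2l // -eqz_mod_dvd => /eqP.
rewrite -gg !modz_small; first by case.
  by rewrite lez_nat ltz_nat.
by rewrite lez_nat ltz_nat.
Qed.

(** * Multiplication by a power of r/s modulo r^n - s^n *)

Section Multiplier.
Local Open Scope ring_scope.
Implicit Types (N x y : int).

Lemma eqz_modX N x y k : (x = y %[mod N])%Z -> (x ^+ k = y ^+ k %[mod N])%Z.
Proof. by move=> E; rewrite -modzXm E modzXm. Qed.

Lemma eqz_modM N x x' y y' :
  (x = x' %[mod N])%Z -> (y = y' %[mod N])%Z -> (x * y = x' * y' %[mod N])%Z.
Proof. by move=> E E'; rewrite -modzMm E E' modzMm. Qed.

Lemma eqz_mod_expn N x (n k l : nat) :
  (x ^+ n = 1 %[mod N])%Z -> k = l %[mod n] -> (x ^+ k = x ^+ l %[mod N])%Z.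
Proof.
move=> xn E.
have P m : (x ^+ m = x ^+ (m %% n) %[mod N])%Z.
  rewrite {1}(divn_eq m n) exprD mulnC exprM -[X in _ = modz X _]mul1r.
  by apply: eqz_modM => //; rewrite (eqz_modX _ xn) expr1n.
by rewrite P E -P.
Qed.

Definition residue (n : nat) (A : int) : nat := `|(A %% n)%Z|%N.

Lemma residueE n A : (0 < n)%N -> Posz (residue n A) = (A %% n)%Z.
Proof. by move=> n0; rewrite gez0_abs // modz_ge0 // -lt0n. Qed.

Lemma exists_inverse N x : coprimez x N -> exists y, (x * y = 1 %[mod N])%Z.
Proof.
case/coprimezP=> -[y t] /= E; exists y; apply/eqP; rewrite eqz_mod_dvd -E.
by rewrite mulrC opprD addrA subrr sub0r dvdzE abszN -dvdzE dvdz_mull.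
Qed.

Lemma exists_natural_inverse (n : nat) x :
  (0 < n)%N -> coprimez x n -> exists B : nat, (x * B%:Z = 1 %[mod n])%Z.
Proof.
move=> n0 /exists_inverse[y E]; exists (residue n y).
by rewrite residueE // modzMmr.
Qed.

(** The multiplier is v = (r/s)^B with A B = 1 modulo n, so that v^A = r/s and
    v^n = 1 modulo N = r^n - s^n.  As s and N are coprime, gcd(N, v^j - 1) is
    gcd(N, r^(B j) - s^(B j)), and B drops out of the exponent (n, B j) because
    it is prime to n.  For n = 1 the shift is the identity and v = 1. *)
Lemma exists_multiplier (n : nat) (r s A : int) :
    (0 < n)%N -> n = 1%N \/ coprimez r s /\ coprimez A n ->
  exists v : int,
  [/\ (v ^+ n = 1 %[mod r ^+ n - s ^+ n])%Z,
      (r = v ^+ residue n A * s %[mod r ^+ n - s ^+ n])%Z,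
      forall (H : groupType) (a y : H), (a ^+ n)%g = 1%g ->
        (expgz y r * expgz a A)%g = (expgz a A * expgz y s)%g ->
        (a * y)%g = (expgz y v * a)%g
    & forall j, gcdz (r ^+ n - s ^+ n) (v ^+ j - 1) = `|r ^+ gcdn n j - s ^+ gcdn n j| ].
Proof.
move=> n0 [n1|[rs An]].
  rewrite n1 /residue modz1 !expr1; exists 1; split.
  - by rewrite expr1n.
  - by apply/eqP; rewrite mul1r eqz_mod_dvd.
  - by move=> H a y; rewrite expg1 => -> _; rewrite mul1g mulg1.
  - by move=> j; rewrite expr1n subrr gcdz0 gcd1n !expr1 abszE.
set N := r ^+ n - s ^+ n.
have rsN : (r ^+ n = s ^+ n %[mod N])%Z by apply/eqP; rewrite eqz_mod_dvd.
have sN : coprimez s N by apply: coprimez_diffX.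
have [s' ss'] := exists_inverse sN.
have [B AB] := exists_natural_inverse n0 An; pose u := r * s'.
have us : (u * s = r %[mod N])%Z.
  by rewrite /u -mulrA (mulrC s') -[X in _ = modz X _]mulr1; apply: eqz_modM.
have un : (u ^+ n = 1 %[mod N])%Z.
  rewrite /u exprMn (eqz_modM rsN (erefl _)) -exprMn (eqz_modX _ ss') expr1n //.
have Bn : coprimez B n.
  apply/coprimezP; exists (A, - ((A * B%:Z - 1) %/ n)%Z) => /=.
  have : (n %| A * B%:Z - 1)%Z by rewrite -eqz_mod_dvd; apply/eqP.
  by move/divzK => E; rewrite mulNr E; ring.
exists (u ^+ B); split.
- by rewrite -exprM mulnC exprM (eqz_modX _ un) expr1n.
- rewrite -{1}us; apply: eqz_modM => //; rewrite -exprM -{1}(expr1 u).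
  apply/esym/(eqz_mod_expn un)/eqP.
  by rewrite -eqz_nat -!modz_nat PoszM residueE // modzMmr mulrC AB.
- move=> H a y an1 rel; apply: (relation_normalize an1 rel _ ss' _ AB) => // i k.
  exact: expgz_eq_mod (relation_power an1 rel (dvdz_mull _ (dvdzz _))).
- move=> j; rewrite -exprM -(Gauss_gcdzr _ (_ : coprimez N (s ^+ (B * j)))); last first.
    by rewrite coprimez_sym coprimezXl.
  have E : (s ^+ (B * j) * (u ^+ (B * j) - 1) = r ^+ (B * j) - s ^+ (B * j) %[mod N])%Z.
    rewrite mulrBr mulr1 -exprMn (mulrC s) -modzDml (eqz_modX _ us) modzDml //.
  rewrite -gcdz_modr E gcdz_modr gcdz_diffX // Gauss_gcdr // coprime_sym.
  exact: Bn.
Qed.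

(** The affine maps x |-> v x and x |-> x + 1 satisfy the relations of the shift
    and of the twisted generator, and 0 is fixed by the first.  The ring will
    be Z/N, or the integers when N = 0. *)
Lemma affine_model (n : nat) (n_gt0 : (0 < n)%N) (r : nat) (s f A : int)
    (R : comUnitRingType) (v : R) :
  (f * (r%:Z - s) = 0 %[mod n])%Z ->
  v ^+ n = 1 -> r%:R = v ^+ residue n A * s%:~R ->
  exists tau : classM_group n_gt0 r s f A -> R,
    forall i, tau (expgz (twisted_gen n_gt0 r s f A) i 1%g) = i%:~R.
Proof.
move=> frs vn rvs.
have vK : cancel ( *%R v) ( *%R (v ^+ n.-1)).
  by move=> x; rewrite mulrA -exprSr prednK // vn mul1r.
have vK' : cancel ( *%R (v ^+ n.-1)) ( *%R v).
  by move=> x; rewrite mulrA -exprS prednK // vn mul1r.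
pose a' := MkBij vK vK'.
pose y' := MkBij (addrK (1 : R)) (subrK (1 : R)).
have aE k (z : R) : (a' ^+ k)%g z = v ^+ k * z.
  by rewrite bij_expE; elim: k => [|k /= ->]; rewrite ?mul1r // exprS mulrA.
have yE i (x : R) : expgz y' i x = x + i%:~R.
  have P k (z : R) : (y' ^+ k)%g z = z + k%:R.
    by rewrite bij_expE; elim: k => [|k /= ->]; rewrite ?addr0 // -addrA -natr1.
  case: i => k; first exact: P.
  apply: (can_inj (bfunK (y' ^+ k.+1)%g)); rewrite [RHS]P -addrA NegzE mulrNz addNr addr0.
  exact: (binvK (y' ^+ k.+1)%g).
have a'n : (a' ^+ n)%g = 1%g.
  by apply: bij_ext => x; rewrite aE vn mul1r.
have [|||tau [tau1 _ tauy]] := @orbit_map n n_gt0 r s f A frs R a' y' 0 => //.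
- by rewrite /= mulr0.
- apply: bij_ext => x; rewrite !bij_mulE.
  rewrite -(expgz_modn a'n A) -residueE // expgz_nat !aE yE -expgz_nat yE.
  by rewrite mulrDr -rvs.
by exists tau => i; rewrite (equivariant_expgz _ _ tauy) tau1 yE add0r.
Qed.

End Multiplier.

(** * Infinite groups in the class *)

Lemma injective_infinite (T : Type) (P : nat -> T) :
  injective P -> ~ finite_set [set: T]%classic.
Proof.
move=> Pinj /(sub_finite_set (@subsetT _ (P @` setT)%classic)).
by rewrite (eq_finite_set (inj_card_eq (in2W Pinj))); apply: infinite_nat.
Qed.

Section Rotations.
Local Open Scope ring_scope.
Variables (n : nat) (n_gt0 : (0 < n)%N) (r : nat) (s f A : int).
Hypotheses (frs : (f * (r%:Z - s) = 0 %[mod n])%Z) (n_gt1 : (1 < n)%N).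
Local Notation G := (classM_group n_gt0 r s f A).
Local Notation A0 := (residue n A).

(** With f_k the affine map z |-> mu_k (z - c_k) + c_k, the product f_0 f_1 is
    f_1 f_0 followed by the translation by
    delta = (1 - mu_0) (1 - mu_1) (c_0 - c_1).
    Conjugating the action of y by that of a moves f_1 to the coordinate 0, so a
    commutator acts there as a translation of infinite order.  The last two
    hypotheses express the relation y^r a^A = a^A y^s coordinatewise: both sides
    have linear part mu_k^r, and they agree at one point only if the centres do,
    unless the linear part is 1. *)
Lemma rotations_infinite (mu c : nat -> algC) :
  (forall k, mu k != 0) -> mu 0%N != 1 -> mu 1%N != 1 -> c 0%N != c 1%N ->
  (forall k, mu (k %% n)%N = mu k) -> (forall k, c (k %% n)%N = c k) ->
  (forall k, mu k ^+ r = mu (k + A0)%N ^ s) ->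
  (forall k, mu k ^+ r = 1 \/ c (k + A0)%N = c k) ->
  ~ finite_set [set: G]%classic.
Proof.
move=> mu0 mu0n mu1n c01 mun cn murs muc.
pose T := 'I_n -> algC.
pose at_ (F : T) : T := fun i => F (ordS i).
have at_E k F i : iter k at_ F i = F (iter k (@ordS n) i).
  by elim: k F i => // k IHk F i /=; rewrite /at_ IHk -iterSr.
have at_n F : iter n at_ F = F.
  apply/funext => i; rewrite at_E; congr F; apply: ord_inj.
  by rewrite iter_ordS modnDr modn_small.
have atK : cancel at_ (iter n.-1 at_).
  by move=> F; rewrite -iterSr prednK.
have atK' : cancel (iter n.-1 at_) at_.
  by move=> F; rewrite -iterS prednK.
pose a' := MkBij atK atK'.
pose rot (m : nat -> algC) (F : T) : T := fun i => m i * (F i - c i) + c i.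
have rotK : cancel (rot mu) (rot (fun k => (mu k)^-1)).
  by move=> F; apply/funext => i; rewrite /rot addrK mulKf ?subrK.
have rotK' : cancel (rot (fun k => (mu k)^-1)) (rot mu).
  by move=> F; apply/funext => i; rewrite /rot addrK mulVKf ?subrK.
pose y' := MkBij rotK rotK'.
have yE k F i : expgz y' k F i = mu i ^ k * (F i - c i) + c i.
  have P l F' : (y' ^+ l)%g F' i = mu i ^+ l * (F' i - c i) + c i.
    rewrite bij_expE; elim: l => [|l /= IHl]; first by rewrite mul1r subrK.
    by rewrite {1}/rot IHl addrK mulrA -exprS.
  case: k => k; first exact: P.
  apply: (can_inj (addrK (- c i))); rewrite addrK.
  apply: (mulfI (expf_neq0 k.+1 (mu0 i))); apply: (can_inj (addrK (c i))).
  rewrite -P NegzE -exprnN mulVKf ?expf_neq0 // subrK.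
  by congr (_ i); apply: (binvK (y' ^+ k.+1)%g).
have a'n : (a' ^+ n)%g = 1%g by apply: bij_ext => F; rewrite bij_expE.
have [||tau [tau1 taua tauy]] :=
    @orbit_map n n_gt0 r s f A frs T a' y' (fun=> 0) a'n.
- by [].
- apply: bij_ext => F; apply/funext => i; rewrite !bij_mulE.
  rewrite -(expgz_modn a'n A) -residueE // expgz_nat !bij_expE.
  rewrite -!bij_expE -expgz_nat yE !bij_expE !at_E yE /= iter_ordS mun cn.
  rewrite -murs -exprnP; case: (muc i) => [->|-> //].
  by rewrite !mul1r !subrK.
pose comm (H : groupType) (a y : H) :=
  ((y * (a * y * a^-1)) * ((a * y * a^-1) * y)^-1)%g.
pose yG := twisted_gen n_gt0 r s f A; pose aG := shift_bij n_gt0 r s f A.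
have equiv_inv (g : bij_of G) (h : bij_of T) :
    (forall x, tau (g x) = h (tau x)) ->
    forall x, tau ((g^-1)%g x) = (h^-1)%g (tau x).
  by move=> E x; apply: (@equivariant_expgz _ _ tau g h (-1)).
have equiv_mul (g g' : bij_of G) (h h' : bij_of T) :
    (forall x, tau (g x) = h (tau x)) -> (forall x, tau (g' x) = h' (tau x)) ->
    forall x, tau ((g * g')%g x) = (h * h')%g (tau x).
  by move=> E E' x; rewrite !bij_mulE E E'.
have tau_comm g : tau (comm _ aG yG g) = comm _ a' y' (tau g).
  have tauC := equiv_mul _ _ _ _ (equiv_mul _ _ _ _ taua tauy) (equiv_inv _ _ taua).
  have tauV := equiv_inv _ _ (equiv_mul _ _ _ _ tauC tauy).
  exact: equiv_mul (equiv_mul _ _ _ _ tauy tauC) tauV g.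
pose i0 := Ordinal n_gt0.
pose delta := (1 - mu 0%N) * (1 - mu 1%N) * (c 0%N - c 1%N).
have comm0 F : comm _ a' y' F i0 = F i0 + delta.
  have E F' : ((a' * y' * a'^-1)%g F') i0 = mu 1%N * (F' i0 - c 1%N) + c 1%N.
    have i1 : ordS i0 = 1%N :> nat by rewrite /= modn_small.
    have F'0 : (a'^-1)%g F' (ordS i0) = F' i0.
      by rewrite -[in RHS](binvK a' F').
    by rewrite !bij_mulE -F'0 /= /at_ /rot i1.
  rewrite /comm; move: (a' * y' * a'^-1)%g E => b E.
  (* evaluating at F = b (y F') avoids computing any inverse *)
  have [F' ->] : exists F', F = (b * y')%g F'.
    by exists (((b * y')^-1)%g F); rewrite -bij_mulE mulgV.
  rewrite -[in LHS]bij_mulE mulgVK !bij_mulE E.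
  rewrite -[(y' (b F')) i0]/(mu 0%N * (b F' i0 - c 0%N) + c 0%N) E.
  rewrite -[(y' F') i0]/(mu 0%N * (F' i0 - c 0%N) + c 0%N) /delta.
  by ring.
have comm0X k : ((comm _ a' y' ^+ k)%g (fun=> 0)) i0 = k%:R * delta.
  rewrite bij_expE; elim: k => [|k IHk]; first by rewrite mul0r.
  by rewrite iterS comm0 IHk -natr1 mulrDl mul1r.
apply: (@injective_infinite _ (fun k => (comm _ aG yG ^+ k)%g 1%g)) => k l E.
have delta0 : delta != 0 by rewrite !mulf_neq0 // subr_eq0 // eq_sym.
have := congr1 (fun g => tau g i0) E.
rewrite -!expgz_nat !(equivariant_expgz _ _ tau_comm) tau1 !expgz_nat !comm0X.
by move/(mulIf delta0)/eqP; rewrite eqr_nat => /eqP.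
Qed.

End Rotations.

Section PrimeObstructions.
Local Open Scope ring_scope.
Variables (n : nat) (n_gt0 : (0 < n)%N) (r : nat) (s f A : int) (p : nat).
Hypotheses (frs : (f * (r%:Z - s) = 0 %[mod n])%Z) (p_prime : prime p).
Local Notation G := (classM_group n_gt0 r s f A).
Local Notation A0 := (residue n A).

Lemma prime_primitive_neq0 (z : algC) : p.-primitive_root z -> z != 0.
Proof.
move=> zp; apply: contra_eq_neq (prim_expr_order zp) => ->.
by rewrite expr0n gtn_eqF ?prime_gt0 // eq_sym oner_neq0.
Qed.

Lemma primitive_exprz_mod (z : algC) (i j : int) :
  p.-primitive_root z -> (i = j %[mod p])%Z -> z ^ i = z ^ j.
Proof.
move=> zp /eqP; rewrite eqz_mod_dvd => /dvdzP[q E].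
have z0 := prime_primitive_neq0 zp.
have -> : i = j + p%:Z * q by rewrite mulrC -E addrC subrK.
by rewrite expfzDr // -exprz_exp -exprnP prim_expr_order // exp1rz mulr1.
Qed.

Lemma prime_primitive_neq1 (z : algC) : p.-primitive_root z -> z != 1.
Proof.
move=> zp; rewrite -[z]expr1 -(prim_order_dvd zp).
by rewrite dvdn1 neq_ltn prime_gt1 ?orbT.
Qed.

(** Here mu is constant, a p-th root of unity: the powers mu^r and mu^s are 1,
    which leaves the centres free. *)
Lemma common_prime_infinite :
  (1 < n)%N -> (p %| r%:Z)%Z -> (p %| s)%Z -> ~ finite_set [set: G]%classic.
Proof.
move=> n1 pr ps.
have [z zp] := C_prim_root_exists (prime_gt0 p_prime).
have z1 := prime_primitive_neq1 zp.
have zE i : (p %| i)%Z -> z ^ i = 1.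
  move=> pi; rewrite -[RHS](expr0z z); apply: primitive_exprz_mod zp _.
  by apply/eqP; rewrite eqz_mod_dvd subr0.
have z0 := prime_primitive_neq0 zp.
apply: (@rotations_infinite n n_gt0 r s f A frs n1 (fun=> z)
  (fun k => (k %% n == 0)%N%:R)) => //.
- by rewrite mod0n modn_small // oner_neq0.
- by move=> k; rewrite modn_mod.
- by move=> k; rewrite exprnP !zE.
- by move=> k; left; rewrite exprnP zE.
Qed.

(** Now the subscripts split into d > 1 classes modulo d that A preserves, and
    the centres c_k = c^k, for c a primitive d-th root of unity, depend on the
    class only.  Within a class, adding A to the subscript is a cyclic
    permutation of order m = n/d, along which mu must satisfy
    mu_k^r = mu_(k+A)^s: its exponent is multiplied by rho = r/s modulo p at
    each step, and this closes up since rho^m = 1 modulo p.  The integer B,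
    inverse to A/d modulo m, counts the steps from a subscript to the next one
    in its class. *)
Lemma noncoprime_shift_infinite (d := gcdn n A0) :
  (1 < d)%N -> (p %| (r%:Z ^+ (n %/ d) - s ^+ (n %/ d))%R)%Z -> ~~ (p %| s)%Z ->
  ~ finite_set [set: G]%classic.
Proof.
move=> d1 prs ps; set m := (n %/ d)%N in prs.
have d0 : (0 < d)%N by apply: ltnW.
have dn : (d %| n)%N by apply: dvdn_gcdl.
have dA : (d %| A0)%N by apply: dvdn_gcdr.
have nE : n = (m * d)%N by rewrite divnK.
have m0 : (0 < m)%N by rewrite divn_gt0 // dvdn_leq.
have n1 : (1 < n)%N by apply: leq_trans d1 _; apply: dvdn_leq.
have sp : coprimez s p by rewrite coprimez_sym coprimezE prime_coprime.
have [s' ss'] := exists_inverse sp.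
pose rho := r%:Z * s'.
have rho_s : (rho * s = r%:Z %[mod p])%Z.
  by rewrite /rho -mulrA (mulrC s') -[X in _ = modz X _]mulr1; apply: eqz_modM.
have rho_m : (rho ^+ m = 1 %[mod p])%Z.
  have rsm : (r%:Z ^+ m = s ^+ m %[mod p])%Z by apply/eqP; rewrite eqz_mod_dvd.
  by rewrite /rho exprMn (eqz_modM rsm (erefl _)) -exprMn (eqz_modX _ ss') expr1n.
have [B AB] : exists B, (B * (A0 %/ d) = 1 %[mod m])%N.
  have cop : coprimez (A0 %/ d)%N m.
    rewrite coprimez_sym coprimezE !absz_nat /coprime -(eqn_pmul2r d0).
    by rewrite muln_gcdl !divnK // mul1n.
  have [B E] := exists_natural_inverse m0 cop; exists B; rewrite mulnC.
  by apply/eqP; rewrite -eqz_nat -!modz_nat PoszM E.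
have [z zp] := C_prim_root_exists (prime_gt0 p_prime).
have [c cd] := C_prim_root_exists d0.
have z0 := prime_primitive_neq0 zp.
pose e k := rho ^+ (B * (k %/ d)).
apply: (@rotations_infinite n n_gt0 r s f A frs n1 (fun k => z ^ e k) (fun k => c ^+ k)).
- by move=> k; rewrite expfz_neq0.
- by rewrite /e div0n muln0 expr1z prime_primitive_neq1.
- by rewrite /e divn_small // muln0 expr1z prime_primitive_neq1.
- rewrite eq_sym expr1 expr0 -[c]expr1 -(prim_order_dvd cd).
  by rewrite dvdn1 neq_ltn d1 orbT.
- move=> k; apply: primitive_exprz_mod zp _; apply: (eqz_mod_expn rho_m).
  have -> : (k %/ d = k %/ n * m + k %% n %/ d)%N.
    by rewrite {1}(divn_eq k n) {2}nE mulnA divnMDl.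
  by rewrite mulnDr mulnA -modnDml modnMl.
- by move=> k; rewrite -(prim_expr_mod cd) modn_dvdm // prim_expr_mod.
- move=> k; rewrite exprnP !exprz_exp; apply: primitive_exprz_mod zp _.
  rewrite /e divnDr // mulnDr exprD -mulrA; apply: eqz_modM => //.
  have E := eqz_mod_expn rho_m AB; rewrite expr1 in E.
  by rewrite (eqz_modM E (erefl _)).
- move=> k; right; rewrite exprD; case/dvdnP: dA => q ->.
  by rewrite mulnC exprM (prim_expr_order cd) expr1n mulr1.
Qed.

End PrimeObstructions.

(** * Finite nontrivial groups in the class *)

Lemma exists_prime_dvd (k : nat) : k != 1%N -> exists2 p, prime p & (p %| k)%N.
Proof.
case: k => [|[|k]] // _; first by exists 2.
by exists (pdiv k.+2); [apply: pdiv_prime | apply: pdiv_dvd].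
Qed.

Lemma Zp_intr_eq (M : nat) (i k : int) : (1 < M)%N ->
  (i%:~R = k%:~R :> 'Z_M)%R <-> (i = k %[mod M])%Z.
Proof.
move=> M1.
have nat0 (l : nat) : ((l%:R : 'Z_M) == 0)%R = (M %| l)%N.
  by rewrite -val_eqE /= val_Zp_nat.
have int0 (l : int) : ((l%:~R : 'Z_M) == 0)%R = (M %| l)%Z.
  by case: l => l; rewrite ?NegzE ?mulrNz ?oppr_eq0 dvdzE ?abszN; apply: nat0.
by split=> /eqP E; apply/eqP; move: E; rewrite eqz_mod_dvd -int0 rmorphB subr_eq0.
Qed.

(** Consecutive positive integers have g-th powers that differ by more than 1
    as soon as g > 1. *)
Lemma dist_expn_eq1 (r : nat) (s : int) (g : nat) :
  (0 < g)%N -> absz (r%:Z ^+ g - s ^+ g)%R = 1%N ->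
  `|r%:Z - s|%R = 1%R /\ [\/ g = 1%N, r = 0%N | s = 0%R].
Proof.
move=> g0 E.
have rs1 : absz (r%:Z - s)%R = 1%N.
  by apply/eqP; rewrite -dvdn1 -E subrXX abszM dvdn_mulr.
split; first by rewrite -abszE rs1.
have [->|g1] := eqVneq g 1%N; first exact: Or31.
have [->|r0] := eqVneq r 0%N; first exact: Or32.
have [->|s0] := eqVneq s 0%R; first exact: Or33.
have grow x : (0 < x)%N -> (x ^ g + 1 < x.+1 ^ g)%N.
  case: g g0 g1 {E} => [|[|g]] // _ _ x0.
  have lt : (x ^ g.+1 < x.+1 ^ g.+1)%N by rewrite ltn_exp2r.
  rewrite expnS [X in (_ < X)%N]expnS.
  have := leq_mul (leqnn x.+1) lt; have : (0 < x ^ g.+1)%N by rewrite expn_gt0 x0.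
  by nia.
have s_abs : s = Posz `|s|%N by lia.
have PX x : (Posz x ^+ g)%R = Posz (x ^ g) by rewrite -!natz natrX.
move: E; rewrite s_abs !PX => E.
have [rE|sE] : (r = `|s|.+1 \/ `|s| = r.+1)%N by lia.
  have s1 : (0 < `|s|)%N by lia.
  by move: (grow _ s1) E; rewrite -rE; move: (expn _ _) (expn _ _) => u t; lia.
have r1 : (0 < r)%N by lia.
by move: (grow _ r1) E; rewrite -sE; move: (expn _ _) (expn _ _) => u t; lia.
Qed.

Section Structure.
Variables (n : nat) (n_gt0 : (0 < n)%N) (r : nat) (s f A : int).
Hypothesis frs : (f * (r%:Z - s) = 0 %[mod n])%Z.
Local Notation G := (classM_group n_gt0 r s f A).
Local Notation a := (shift_bij n_gt0 r s f A).
Local Notation y := (twisted_gen n_gt0 r s f A).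
Local Notation N := (r%:Z ^+ n - s ^+ n)%R.
Local Notation P i := (expgz y i 1%g).

Lemma twisted_gen1_trivial (k : int) :
  absz k = 1%N -> expgz y k = 1%g -> forall g : G, g = 1%g.
Proof.
move=> k1 yk; have y1 : y = 1%g.
  have [E|E] : k = 1%R \/ k = (-1)%R by lia.
    by rewrite -yk E.
  by rewrite -[y]invgK -[(y^-1)%g]/(expgz y (-1)) -E yk invg1.
apply: (twisted_gen_orbit (S := fun g : G => g = 1%g)) => // [g ->|g i ->].
  exact: shift_bij1.
by apply: fixed_expgz; rewrite y1.
Qed.

Hypothesis G_finite : finite_set [set: G]%classic.
Hypothesis G_nontrivial : exists g : G, g <> 1%g.

(** If d = (n, A) > 1, then either a prime divides r^m - s^m for m = n/d, and it
    is prime to s because r and s are coprime, or else y^(r^m - s^m) = 1 forces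
    y = 1. *)
Lemma finite_coprime : n = 1%N \/ coprimez r s /\ coprimez A n.
Proof.
have [->|n1] := eqVneq n 1%N; [by left|right].
have {}n1 : (1 < n)%N by lia.
have rs : coprimez r s.
  apply: contraT; rewrite coprimezE => /exists_prime_dvd[p p_prime].
  rewrite dvdn_gcd => /andP[pr ps].
  by exfalso; apply: (common_prime_infinite frs p_prime n1 pr ps G_finite).
split=> //; pose A0 := residue n A; pose d := gcdn n A0.
have dE : coprimez A n = (d == 1%N).
  by rewrite coprimez_sym /coprimez -gcdz_modr -residueE.
rewrite dE; apply: contraT => d1; set m := (n %/ d)%N.
have d0 : (0 < d)%N by rewrite gcdn_gt0 n_gt0.
have nE : n = (m * d)%N by rewrite divnK // dvdn_gcdl.
have m0 : (0 < m)%N by rewrite divn_gt0 // dvdn_leq // dvdn_gcdl.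
have [m1|] := eqVneq (absz (r%:Z ^+ m - s ^+ m)%R) 1%N.
  have nAm : (n %| (A * m%:Z)%R)%Z.
    have [q qE] := dvdnP (dvdn_gcdr n A0).
    have -> : (n %| (A * m%:Z)%R)%Z = (n %| (A0%:Z * m%:Z)%R)%Z.
      have modE z : (n %| z)%Z = (z == 0 %[mod n])%Z by rewrite eqz_mod_dvd subr0.
      by rewrite !modE residueE // modzMml.
    by rewrite -PoszM dvdzE !absz_nat qE -/d -mulnA {1}nE (mulnC d) dvdn_mull.
  have [g g1] := G_nontrivial; case: g1.
  apply: (twisted_gen1_trivial m1); move: nAm.
  by apply: relation_power; [apply: shift_bij_order | apply: twisted_gen_rel].
case/exists_prime_dvd=> p p_prime pm.
case: (@noncoprime_shift_infinite n n_gt0 r s f A p frs p_prime) => //.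
  by rewrite -/A0 -/d; lia.
apply/negP => ps; have pr : (p %| r%:Z)%Z.
  have : (p %| r%:Z ^+ m)%Z%R.
    rewrite -[(_ ^+ m)%R](subrK (s ^+ m)%R) rpredD //.
    by rewrite -(prednK m0) exprS dvdz_mulr.
  by rewrite !dvdzE abszX Euclid_dvdX // => /andP[].
have : (p %| gcdn `|r%:Z%R| `|s|)%N by rewrite dvdn_gcd; apply/andP.
move: rs; rewrite coprimezE => /eqP ->.
by rewrite dvdn1 => /eqP p1; rewrite p1 in p_prime.
Qed.

(** G is Z/N as a set, with the shift acting as multiplication by v.  If N were
    0 the same parametrization by the integers would make G infinite; if N were
    1 or -1 then y = 1 and G would be trivial. *)
Lemma classM_structure : exists v : int,
  [/\ N != 0%R /\ absz N != 1%N,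
      forall g : G, exists i, g = P i,
      forall i k, P i = P k <-> (i = k %[mod N])%Z,
      forall i, a (P i) = P (v * i)%R
    & forall j, gcdz N (v ^+ j - 1)%R = `|r%:Z ^+ gcdn n j - s ^+ gcdn n j|%R ].
Proof.
have an1 := shift_bij_order n_gt0 r s f A.
have rel : (expgz y r%:Z%R * expgz a A = expgz a A * expgz y s)%g.
  exact: twisted_gen_rel.
have [v [vn rvs ay gcdv]] := exists_multiplier n_gt0 finite_coprime.
have yN : expgz y N = 1%g by apply: (relation_power an1 rel); apply: dvdz_mull.
have N1 : absz N != 1%N.
  apply/eqP => N1; have [g] := G_nontrivial; apply.
  exact: twisted_gen1_trivial N1 yN g.
have aP i : a (P i) = P (v * i)%R.
  rewrite -[LHS]bij_mulE (expgz_intertwine _ (ay _ _ _ an1 rel)) bij_mulE.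
  by rewrite shift_bij1 expgzM.
have P_mod i k : P i = P k -> (i = k %[mod N])%Z.
  have [N0|N0] := eqVneq N 0%R.
    move: vn rvs; rewrite N0 !modz0 => vn rvs.
    have [|tau tauE] := @affine_model n n_gt0 r s f A int v frs vn.
    by rewrite intz -rvs natz.
    by move=> /(congr1 tau); rewrite !tauE !intz.
  have M1 : (1 < absz N)%N by rewrite ltn_neqAle eq_sym N1 lt0n absz_eq0.
  have ZE (l m : int) : (l%:~R = m%:~R :> 'Z_(absz N))%R <-> (l = m %[mod N])%Z.
    by rewrite Zp_intr_eq // modz_abs modz_abs.
  have [||tau tauE] := @affine_model n n_gt0 r s f A 'Z_(absz N) v%:~R%R frs.
  - by have /ZE := vn; rewrite rmorphXn.
  - by have /ZE := rvs; rewrite rmorphM rmorphXn.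
  by move=> /(congr1 tau); rewrite !tauE => /ZE.
exists v; split=> //.
- split=> //; apply/eqP => N0.
  apply: (@injective_infinite G (fun k : nat => P k)) G_finite => k l /P_mod.
  by rewrite N0 !modz0 => -[].
- apply: twisted_gen_orbit => [|g [i ->]|g i [k ->]]; first by exists 0%R.
    by exists (v * i)%R.
  by exists (i + k)%R; rewrite expgzD.
- by move=> i k; split=> [/P_mod //|E]; rewrite (expgz_eq_mod yN E).
Qed.

End Structure.

Local Open Scope classical_set_scope.
Local Open Scope card_scope.
Local Open Scope ring_scope.

Theorem theorem6 (n r : nat) (s f A : int) (n_gt0 : (0 < n)%N)
    (f_rs : (f * (r%:Z - s) = 0 %[mod n])%Z)
    (G_finite : finite_set [set: classM_group n_gt0 r s f A])
    (G_nontrivial : exists g : classM_group n_gt0 r s f A, g <> 1%g)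
    (j : nat) (j_lt_n : (j < n)%N) :
  let theta_j := iter j (@classM_shift n n_gt0 r s f A) in
  [/\ Fix theta_j #= `I_(absz (r%:Z ^+ gcdn n j - s ^+ gcdn n j)),
      fixed_point_free theta_j <-> gcdn n j = 1%N /\ `|r%:Z - s| = 1
    & fixed_point_free theta_j ->
      [/\ (f = 0 %[mod n])%Z,
          cyclic_group (classM_group n_gt0 r s f A)
        & [set: classM_group n_gt0 r s f A] #= `I_(absz (r%:Z ^+ n - s ^+ n))]].
Proof.
set y := twisted_gen n_gt0 r s f A; set N := r%:Z ^+ n - s ^+ n.
have [v [[N0 N1] Psurj Pmod aP gcdv]] := classM_structure f_rs G_finite G_nontrivial.
have fixE l : Fix (iter l (@classM_shift n n_gt0 r s f A))
    #= `I_(absz (r%:Z ^+ gcdn n l - s ^+ gcdn n l)).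
  have iterP i : iter l (@classM_shift n n_gt0 r s f A) (expgz y i 1%g)
      = expgz y (v ^+ l * i) 1%g.
    elim: l => [|l IHl]; first by rewrite mul1r.
    by rewrite iterS IHl exprS -mulrA -aP.
  by have := fix_card Psurj Pmod N0 iterP; rewrite gcdv -abszE.
(* the fixed points always include 1, so they reduce to it iff there is one *)
have fpfE : fixed_point_free (iter j (@classM_shift n n_gt0 r s f A))
    <-> absz (r%:Z ^+ gcdn n j - s ^+ gcdn n j) = 1%N.
  have fix1 : Fix (iter j (@classM_shift n n_gt0 r s f A)) 1%g.
    by rewrite /Fix /=; elim: (j) => //= l ->; apply: shift1.
  split=> [fpf|E].
    by have := fixE j; rewrite fpf (card_eql card_set1) => /card_eq_II <-.
  have := fixE j; rewrite E => /eq_cardSP[x _].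
  rewrite II0 card_eq0 => /eqP D.
  have fix_x z : Fix (iter j (@classM_shift n n_gt0 r s f A)) z -> z = x.
    by move=> fz; apply: contrapT => zx; suff : (set0 : set _) z by []; rewrite -D.
  apply/seteqP; split=> [z /fix_x -> /=|_ -> //].
  by rewrite (fix_x _ fix1).
have zX : (0 : int) ^+ n = 0 by rewrite expr0n gtn_eqF.
have g0 : (0 < gcdn n j)%N by rewrite gcdn_gt0 n_gt0.
have fpf_iff : fixed_point_free (iter j (@classM_shift n n_gt0 r s f A))
    <-> gcdn n j = 1%N /\ `|r%:Z - s| = 1.
  rewrite fpfE; split=> [E|[-> E]]; last by rewrite !expr1; lia.
  have [rs1 [g1|rs0|rs0]] := dist_expn_eq1 g0 E; split=> //; exfalso.
    (* r = 0 or s = 0 would give N = 1 or N = -1 *)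
    have s1 : absz s = 1%N by move: rs1; rewrite rs0; lia.
    by move: N1; rewrite /N rs0 zX sub0r abszN abszX s1 exp1n.
  have r1 : r = 1%N by move: rs1; rewrite rs0; lia.
  by move: N1; rewrite /N rs0 zX subr0 abszX r1 exp1n.
split=> // /fpf_iff[g1 rs1]; have f0 : (f = 0 %[mod n])%Z.
  have [E|E] : r%:Z - s = 1 \/ r%:Z - s = - 1 by lia.
    by rewrite -f_rs E mulr1.
  move/eqP: f_rs; rewrite E mulrN1 !eqz_mod_dvd !subr0 dvdzE abszN -dvdzE => fn.
  by apply/eqP; rewrite eqz_mod_dvd subr0.
split=> //; last first.
  (* theta^0 is the identity and gcd(n, 0) = n *)
  have := fixE 0%N; rewrite gcdn0 (_ : Fix _ = [set: _]) //.
  by apply/seteqP; split.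
(* as n divides f, the twist disappears from y, and y^i 1 is a power of x_0 *)
have yE : y = left_mul (pi_word _ [:: (Ordinal n_gt0, false)]).
  apply: bij_ext => g; rewrite /y /twisted_gen bij_mulE.
  rewrite (expgz_order (shift_bij_order n_gt0 r s f A)) //.
  by rewrite -[f]subr0 -eqz_mod_dvd; apply/eqP.
eexists => g; have [i ->] := Psurj g; exists i.
rewrite -/y yE -(gmulf_expgz _ _ (@left_mulM _)).
exact: mulg1.
Qed.
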